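(* Let $L\in\mathbb{R}^{n\times n}$ be the Laplacian of a connected undirected graph on $n$ nodes, let $1\le N_l<n$ be an integer, and let $N_f=n-N_l$. For symmetric $Y\in\mathbb{R}^{n\times n}$ and $y\in\mathbb{R}^n$ with $L\circ Y+\mathrm{diag}(\mathbf{1}-y)$ positive definite, define $$J_f(Y,y)=\mathrm{trace}\Big(\big(L\circ Y+\mathrm{diag}(\mathbf{1}-y)\big)^{-1}\Big)-N_l .$$ (i) The noise-free leader selection problem, namely minimize $\mathrm{trace}(L_f^{-1})$ over $x\in\{0,1\}^n$ with $\mathbf{1}^Tx=N_l$, is equivalent, through the change of variables $y=\mathbf{1}-x$, to the problem of minimizing $J_f(Y,y)$ subject to $$y_i\in\{0,1\},\quad Y_{ij}\in\{0,1\}\ (i,j=1,\dots,n),\quad \mathbf{1}^Ty=N_f,\quad \mathbf{1}^TY\mathbf{1}=N_f^2,\quad Y\succeq 0,\quad \mathrm{rank}(Y)=1.$$ That is, the two problems have the same optimal value, and $(Y,y)$ is optimal for the second problem if and only if $Y=yy^T$ and $x=\mathbf{1}-y$ is optimal for the first. (ii) The problem obtained by dropping the rank constraint and replacing each set $\{0,1\}$ by $[0,1]$, namely minimize $J_f(Y,y)$ subject to $$y_i\in[0,1],\quad Y_{ij}\in[0,1]\ (i,j=1,\dots,n),\quad \mathbf{1}^Ty=N_f,\quad \mathbf{1}^TY\mathbf{1}=N_f^2,\quad Y\succeq 0,$$ is a convex optimization problem (convex objective function and convex constraint set), and its optimal value is a lower bound on the optimal value of the noise-free leader selection problem.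
   Context: $\mathbf{1}$ is the vector of all ones, $\mathrm{diag}(v)$ is the diagonal matrix with the vector $v$ on its diagonal, $\circ$ is the elementwise (Hadamard) product of matrices, and $Y\succeq 0$ means $Y$ is symmetric positive semidefinite. An entry $x_i=1$ means node $i$ is a leader and $x_i=0$ means node $i$ is a follower; $N_l$ and $N_f$ are the numbers of leaders and followers. For $x\in\{0,1\}^n$, $L_f$ denotes the matrix obtained from $L$ by deleting all rows and columns indexed by leaders (indices $i$ with $x_i=1$). In both optimization problems over $(Y,y)$, the domain of $J_f$ is the set of pairs for which $L\circ Y+\mathrm{diag}(\mathbf{1}-y)$ is positive definite (pairs outside the domain are regarded as infeasible, or as having objective value $+\infty$). *)

(* Defs.v *)
From HB Require Import structures.
From mathcomp Require Import all_boot all_order all_algebra.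
From mathcomp Require Import all_classical all_reals all_analysis.

Set Implicit Arguments.
Unset Strict Implicit.
Unset Printing Implicit Defensive.

Import Order.TTheory GRing.Theory Num.Theory.

Local Open Scope classical_set_scope.
Local Open Scope ring_scope.

(* A simple graph on n nodes is a symmetric irreflexive relation on 'I_n. *)
Definition laplacian (R : realType) (n : nat) (e : rel 'I_n) : 'M[R]_n :=
  \matrix_(i, j) (if i == j then #|e i|%:R else - (e i j)%:R).

Definition hadamard (R : realType) (m n : nat) (A B : 'M[R]_(m, n)) :
    'M[R]_(m, n) :=
  map2_mx *%R A B.

Definition posdef (R : realType) (n : nat) (A : 'M[R]_n) : Prop :=
  A^T = A /\ forall v : 'cV[R]_n, v != 0 -> 0 < (v^T *m A *m v) 0 0.

Definition possemidef (R : realType) (n : nat) (A : 'M[R]_n) : Prop :=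
  A^T = A /\ forall v : 'cV[R]_n, 0 <= (v^T *m A *m v) 0 0.

Section Minimization.
Variables (R : realType) (T : Type).
Implicit Types (F : set T) (f : T -> R).

Definition optimal_value F f : \bar R := ereal_inf [set (f p)%:E | p in F].

Definition optimal F f (p : T) : Prop :=
  F p /\ forall q, F q -> f p <= f q.

End Minimization.

(* Minimizing f, with effective domain D, over the constraint set C. *)
Definition convex_problem (R : realType) (M : lmodType R)
    (D : set M) (f : M -> R) (C : set M) : Prop :=
  [/\ convex_set (D : set (convex_lmodType M)),
      convex_function (D : set (convex_lmodType M)) (f : _ -> R^o)
    & convex_set (C : set (convex_lmodType M))].

Section LeaderSelection.
Variables (R : realType) (n : nat).
Implicit Types (L : 'M[R]_n) (x : 'cV[R]_n) (p : 'M[R]_n * 'cV[R]_n).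

Definition follower x : pred 'I_n := [pred i | x i 0 != 1].

Definition follower_block L x : 'M[R]_#|follower x| :=
  mxsub (@enum_val _ (follower x)) (@enum_val _ (follower x)) L.

Definition leader_cost L x : R := \tr (invmx (follower_block L x)).

Definition leader_feasible (Nl : nat) : set 'cV[R]_n :=
  [set x : 'cV[R]_n | (forall i, [set 0; 1] (x i 0)) /\ \sum_i x i 0 = Nl%:R].

(* A point (Y, y) of the lifted problems is a pair p with p.1 = Y, p.2 = y. *)
Definition lifted_mx L p : 'M[R]_n :=
  hadamard L p.1 + diag_mx (const_mx 1 - p.2)^T.

Definition Jf_dom L : set ('M[R]_n * 'cV[R]_n) :=
  [set p : 'M[R]_n * 'cV[R]_n | p.1^T = p.1 /\ posdef (lifted_mx L p)].

Definition Jf L (Nl : nat) p : R := \tr (invmx (lifted_mx L p)) - Nl%:R.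

(* S is the set of values allowed for the entries: {0, 1} or [0, 1]. *)
Definition lifted_constraints (S : set R) (Nf : nat) :
    set ('M[R]_n * 'cV[R]_n) :=
  [set p : 'M[R]_n * 'cV[R]_n |
    [/\ forall i, S (p.2 i 0),
        forall i j, S (p.1 i j),
        \sum_i p.2 i 0 = Nf%:R,
        \sum_i \sum_j p.1 i j = Nf%:R ^+ 2
      & possemidef p.1]].

Definition rank1_constraints (Nf : nat) : set ('M[R]_n * 'cV[R]_n) :=
  lifted_constraints [set 0; 1] Nf `&`
    [set p : 'M[R]_n * 'cV[R]_n | \rank p.1 = 1%N].

Definition relaxed_constraints (Nf : nat) : set ('M[R]_n * 'cV[R]_n) :=
  lifted_constraints `[0, 1] Nf.

End LeaderSelection.

Arguments leader_feasible : clear implicits.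
Arguments rank1_constraints : clear implicits.
Arguments relaxed_constraints : clear implicits.

(* Main.v *)
Require Import Defs.
From HB Require Import structures.
From mathcomp Require Import all_boot all_order all_algebra.
From mathcomp Require Import all_classical all_reals all_analysis.
From mathcomp Require Import ring lra.

Set Implicit Arguments.
Unset Strict Implicit.
Unset Printing Implicit Defensive.

Import Order.TTheory GRing.Theory Num.Theory.

Local Open Scope classical_set_scope.
Local Open Scope ring_scope.

(* The Laplacian form vanishes only on constant vectors (connectedness), so
   with at least one leader the matrix lifted from [Y = y y^T] is positive
   definite; up to a permutation it is block diagonal with blocks [L_f] and an
   identity of size [Nl]. Conversely, a 0/1 positive semidefinite matrix of
   rank one is the outer product of its diagonal, and the domain of [Jf]
   identifies that diagonal with [y]. Convexity holds because
   [b^T A^-1 b = max_v (2 b^T v - v^T A v)] is a supremum of functions affine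
   in [A]. *)

(** * Bilinear forms of matrices and convexity of the trace of the inverse *)

Section BilinearForm.
Variables (R : realType) (n : nat).
Implicit Types (A B : 'M[R]_n) (u v w : 'cV[R]_n) (s t : R).

Definition form A u v : R := (u^T *m A *m v) 0 0.

Lemma formE A u v : form A u v = \sum_i \sum_j u i 0 * A i j * v j 0.
Proof.
rewrite /form mxE exchange_big; apply: eq_bigr => j _.
by rewrite mxE mulr_suml; apply: eq_bigr => i _; rewrite mxE.
Qed.

Lemma formC A u v : A^T = A -> form A u v = form A v u.
Proof.
move=> As; rewrite /form.
transitivity ((u^T *m A *m v)^T 0 0); first by rewrite [RHS]mxE.
by rewrite !trmx_mul trmxK As mulmxA.
Qed.

Lemma form_comb A B s t u v :
  form (s *: A + t *: B) u v = s * form A u v + t * form B u v.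
Proof.
by rewrite /form mulmxDr mulmxDl -!scalemxAr -!scalemxAl !mxE.
Qed.

Lemma form_subr A u v : A^T = A ->
  form A (u - v) (u - v) = form A u u - 2 * form A v u + form A v v.
Proof.
move=> As.
have -> : form A (u - v) (u - v) =
    form A u u - form A u v - (form A v u - form A v v).
  have fB x : form A x (u - v) = form A x u - form A x v.
    by rewrite /form mulmxBr [LHS]mxE [X in _ + X]mxE.
  rewrite -!fB /form [(u - v)^T]linearB /= 2!mulmxBl [LHS]mxE [X in _ + X]mxE.
  by [].
rewrite (formC u v As); ring.
Qed.

Lemma form_delta A i : form A (delta_mx i 0) (delta_mx i 0) = A i i.
Proof.
by rewrite /form trmx_delta -rowE -colE !mxE.
Qed.

Lemma posdef_unitmx A : posdef A -> A \in unitmx.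
Proof.
case=> _ Apos; rewrite -row_free_unit -kermx_eq0; apply/rowV0P => u.
move=> /sub_kermxP uA0; apply/eqP; apply/negPn/negP => u0.
have := Apos u^T; rewrite trmxK uA0 mul0mx mxE ltxx => /(_ _)/negP; apply => //.
by apply: contraNN u0 => /eqP/(congr1 trmx); rewrite trmxK trmx0 => ->.
Qed.

Lemma posdef_semi A : posdef A -> possemidef A.
Proof.
case=> As Apos; split=> // v; have [->|/Apos/ltW//] := eqVneq v 0.
by rewrite mulmx0 mxE.
Qed.

Lemma possemidef_comb A B s t : 0 <= s -> 0 <= t ->
  possemidef A -> possemidef B -> possemidef (s *: A + t *: B).
Proof.
move=> s0 t0 [As A0] [Bs B0]; split=> [|v].
  by rewrite linearD /= !linearZ /= As Bs.
rewrite [X in 0 <= X]form_comb addr_ge0 ?mulr_ge0 //; first exact: A0.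
exact: B0.
Qed.

Lemma posdef_conv A B s t : 0 <= s -> 0 <= t -> s + t = 1 ->
  posdef A -> posdef B -> posdef (s *: A + t *: B).
Proof.
move=> s0 t0 st1 pA pB; have [As Apos] := pA; have [Bs Bpos] := pB.
split=> [|v v0]; first by rewrite linearD /= !linearZ /= As Bs.
rewrite [X in 0 < X]form_comb.
have fA : 0 < form A v v := Apos v v0; have fB : 0 < form B v v := Bpos v v0.
(* If [s > 0] the first term is positive and the second nonnegative; otherwise the weights are [0]
   and [1]. *)
have [s_gt0|s_le0] := ltP 0 s.
  by rewrite ltr_pwDl ?mulr_gt0 // mulr_ge0 // ltW.
have -> : s = 0 by lra.
have -> : t = 1 by lra.
by rewrite mul0r add0r mul1r.
Qed.

(** Completing the square: expand the nonnegative value of the form of [A] at [v - A^-1 u]. *)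
Lemma le_form_invmx A u v : posdef A ->
  2 * (u^T *m v) 0 0 - form A v v <= form (invmx A) u u.
Proof.
move=> pA; have Au := posdef_unitmx pA; have [As _] := pA.
have [_ /(_ (v - invmx A *m u))] := posdef_semi pA.
rewrite [X in 0 <= X]form_subr // => h.
have e1 : form A (invmx A *m u) v = (u^T *m v) 0 0.
  by rewrite /form trmx_mul trmx_inv As mulmxKV.
have e2 : form A (invmx A *m u) (invmx A *m u) = form (invmx A) u u.
  by rewrite /form trmx_mul trmx_inv As mulmxKV // mulmxA.
by move: h; rewrite e1 e2; lra.
Qed.

(** Equality case of the preceding bound, attained at [v = A^-1 u]. *)
Lemma form_invmx A u : posdef A ->
  form (invmx A) u u =
    2 * (u^T *m (invmx A *m u)) 0 0 - form A (invmx A *m u) (invmx A *m u).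
Proof.
move=> pA; have Au := posdef_unitmx pA; have [As _] := pA.
have -> : form A (invmx A *m u) (invmx A *m u) = form (invmx A) u u.
  by rewrite /form trmx_mul trmx_inv As mulmxKV // mulmxA.
by rewrite mulmxA -/(form (invmx A) u u); ring.
Qed.

(** Each diagonal entry of the inverse is its form at a basis vector, to which the variational
    formula applies. *)
Lemma tr_invmx_convex A B s t : 0 <= s -> 0 <= t -> s + t = 1 ->
  posdef A -> posdef B ->
  \tr (invmx (s *: A + t *: B)) <= s * \tr (invmx A) + t * \tr (invmx B).
Proof.
move=> s0 t0 st1 pA pB; have pC := posdef_conv s0 t0 st1 pA pB.
rewrite /mxtrace !mulr_sumr -big_split /=; apply: ler_sum => i _.
rewrite -!form_delta form_invmx // form_comb.
(* [v] is the maximizer for the combined matrix; it serves as a test vector in the bounds for [A]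
   and [B]. *)
set u := delta_mx i 0; set v := _ *m u.
have := le_form_invmx u v pA; have := le_form_invmx u v pB.
have -> : s = 1 - t by lra.
by nra.
Qed.

End BilinearForm.

(** * Convexity of the relaxed problem *)

Section ConvexProblem.
Variables (R : realType) (n : nat).
Implicit Types (L : 'M[R]_n) (p q : 'M[R]_n * 'cV[R]_n) (s t : R).

(** The constant term [diag 1] makes the lifting affine rather than linear, hence the condition on
    the weights. *)
Lemma lifted_mx_conv L s t p q : s + t = 1 ->
  lifted_mx L (s *: p + t *: q) = s *: lifted_mx L p + t *: lifted_mx L q.
Proof.
move=> st1; apply/matrixP => i j; rewrite !mxE.
by have -> : s = 1 - t by [lra]; case: (i == j); rewrite ?mulr1n ?mulr0n; ring.
Qed.

Lemma Jf_dom_conv L s t p q : 0 <= s -> 0 <= t -> s + t = 1 ->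
  Jf_dom L p -> Jf_dom L q -> Jf_dom L (s *: p + t *: q).
Proof.
move=> s0 t0 st1 [ps pd] [qs qd]; split.
  by rewrite /= linearD /= !linearZ /= ps qs.
by rewrite lifted_mx_conv //; exact: posdef_conv.
Qed.

Lemma Jf_conv L Nl s t p q : 0 <= s -> 0 <= t -> s + t = 1 ->
  Jf_dom L p -> Jf_dom L q ->
  Jf L Nl (s *: p + t *: q) <= s * Jf L Nl p + t * Jf L Nl q.
Proof.
move=> s0 t0 st1 [_ pd] [_ qd]; rewrite /Jf lifted_mx_conv //.
have := tr_invmx_convex s0 t0 st1 pd qd.
by have -> : s = 1 - t by [lra]; lra.
Qed.

Lemma relaxed_constraints_conv Nf s t p q : 0 <= s -> 0 <= t -> s + t = 1 ->
  relaxed_constraints R n Nf p -> relaxed_constraints R n Nf q ->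
  relaxed_constraints R n Nf (s *: p + t *: q).
Proof.
have itvP (a b : R) : 0 <= s -> 0 <= t -> s + t = 1 -> `[0, 1]%classic a ->
    `[0, 1]%classic b -> `[0, 1]%classic (s * a + t * b).
  rewrite /= !in_itv /= => s0 t0 st1 /andP[a0 a1] /andP[b0 b1].
  by apply/andP; split; [rewrite addr_ge0 ?mulr_ge0 | nra].
move=> s0 t0 st1 [py pY psy psY pp] [qy qY qsy qsY qp]; split.
- by move=> i; rewrite !mxE; exact: itvP.
- by move=> i j; rewrite !mxE; exact: itvP.
- under eq_bigr do rewrite !mxE.
  by rewrite big_split /= -!mulr_sumr psy qsy -mulrDl st1 mul1r.
- under eq_bigr => i _.
    under eq_bigr do rewrite !mxE.
    rewrite big_split /= -!mulr_sumr; over.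
  by rewrite big_split /= -!mulr_sumr psY qsY -mulrDl st1 mul1r.
- exact: possemidef_comb.
Qed.

Lemma convex_relaxed_problem L Nl Nf :
  convex_problem (Jf_dom L) (Jf L Nl) (relaxed_constraints R n Nf).
Proof.
have conv1 (t : {i01 R}) :
    [/\ 0 <= t%:num, 0 <= 1 - t%:num & t%:num + (1 - t%:num) = 1].
  by split; rewrite ?subr_ge0 // addrC subrK.
split.
- move=> p q t; rewrite !inE => hp hq; case: (conv1 t) => s0 t0 st1.
  exact: (Jf_dom_conv s0 t0 st1).
- move=> t p q; rewrite !inE => hp hq; case: (conv1 t) => s0 t0 st1.
  exact: (Jf_conv _ s0 t0 st1).
- move=> p q t; rewrite !inE => hp hq; case: (conv1 t) => s0 t0 st1.
  exact: (relaxed_constraints_conv s0 t0 st1).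
Qed.

End ConvexProblem.

(** * Block structure of the lifted matrix at [Y = y y^T] *)

Section LeaderCost.
Variables (R : realType) (n : nat) (L : 'M[R]_n) (x : 'cV[R]_n).
Hypothesis x01 : forall i, [set 0; 1] (x i 0).

(* [E] selects the follower coordinates: the lifted matrix is
   [E^T L_f E + diag x], whose inverse is [E^T L_f^-1 E + diag x]. *)
Let F := follower x.
Let E : 'M[R]_(#|F|, n) := rowsub (@enum_val _ F) 1%:M.
Let D : 'M[R]_n := diag_mx x^T.
Let y : 'cV[R]_n := const_mx 1 - x.

Let mulEEt : E *m E^T = 1%:M.
Proof.
rewrite /E mul_rowsub_mx mul1mx; apply/matrixP => i j.
by rewrite !mxE eq_sym (inj_eq enum_val_inj).
Qed.

Let mulEtE : E^T *m E = diag_mx y^T.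
Proof.
apply/matrixP => i j; rewrite !mxE.
under eq_bigr do rewrite !mxE.
(* The sum over enumerated followers becomes a sum over all nodes, where only [k = i] can
   contribute. *)
rewrite -(big_enum_val (fun k : 'I_n => (k == i)%:R * (k == j)%:R : R)) /=.
rewrite big_mkcond (bigD1 i) //= big1 ?addr0 => [|k /negPf ki]; last first.
  by rewrite ki mul0r if_same.
rewrite eqxx mul1r inE /=.
case: (x01 i) => /= ->; rewrite ?eqxx ?subrr ?mul0rn //.
by rewrite subr0 eq_sym oner_eq0.
Qed.

Let mulED : E *m D = 0.
Proof.
apply/matrixP => k j; rewrite mul_mx_diag !mxE.
have xk : x (enum_val k) 0 != 1 := enum_valP k.
have [kj|_] := eqVneq (enum_val k) j; last by rewrite mul0r.
by move: xk; rewrite kj; case: (x01 j) => /= ->; rewrite ?eqxx ?mulr0.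
Qed.

Let mulDD : D *m D = D.
Proof.
rewrite mulmx_diag; congr diag_mx; apply/rowP => j; rewrite !mxE.
by case: (x01 j) => /= ->; rewrite ?mulr0 ?mulr1.
Qed.

Let mulDEt : D *m E^T = 0.
Proof. by rewrite -[LHS]trmxK trmx_mul trmxK tr_diag_mx mulED trmx0. Qed.

Let follower_blockE : follower_block L x = E *m L *m E^T.
Proof.
rewrite /follower_block /E mul_rowsub_mx mul1mx.
apply/matrixP => i j; rewrite !mxE (bigD1 (enum_val j)) //= !mxE eqxx mulr1.
by rewrite big1 ?addr0 // => k kj; rewrite !mxE eq_sym (negPf kj) mulr0.
Qed.

(** The Hadamard product with [y y^T] is multiplication by [diag y] on both sides, and
    [diag y = E^T E]. *)
Let lifted_mxE : lifted_mx L (y *m y^T, y) = E^T *m follower_block L x *m E + D.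
Proof.
rewrite follower_blockE !mulmxA mulEtE -mulmxA mulEtE.
congr (_ + _).
  rewrite mul_diag_mx mul_mx_diag; apply/matrixP => i j.
  by rewrite !mxE big_ord1 !mxE; ring.
by rewrite /= /y opprB addrC subrK.
Qed.

Let follower_blockE2 :
  follower_block L x = E *m lifted_mx L (y *m y^T, y) *m E^T.
Proof.
rewrite lifted_mxE mulmxDr mulED addr0 !mulmxA mulEEt mul1mx.
by rewrite -mulmxA mulEEt mulmx1.
Qed.

(** The follower block is the compression of the lifted matrix by [E^T], which is injective since
    [E E^T = 1]. *)
Lemma posdef_follower_block :
  posdef (lifted_mx L (y *m y^T, y)) -> posdef (follower_block L x).
Proof.
case=> Ms Mpos; split.
  by rewrite follower_blockE2 !trmx_mul trmxK Ms mulmxA.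
move=> v v0; rewrite follower_blockE2 !mulmxA -(mulmxA _ E^T v).
rewrite -[v^T *m E]trmxK trmx_mul trmxK; apply: Mpos.
apply: contraNneq v0 => /(congr1 (mulmx E)).
by rewrite mulmxA mulEEt mul1mx mulmx0 => ->.
Qed.

(** In the trace of the explicit inverse, the leader block [D] contributes exactly [Nl], the offset
    subtracted in [Jf]. *)
Lemma Jf_outer (Nl : nat) : \sum_i x i 0 = Nl%:R ->
  posdef (lifted_mx L (y *m y^T, y)) ->
  Jf L Nl (y *m y^T, y) = leader_cost L x.
Proof.
move=> sx pM; have Au := posdef_unitmx (posdef_follower_block pM).
have Mu := posdef_unitmx pM.
set A := follower_block L x in Au *.
have MN : lifted_mx L (y *m y^T, y) *m (E^T *m invmx A *m E + D) = 1%:M.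
  rewrite lifted_mxE -/A mulmxDl !mulmxDr mulDD.
  rewrite (mulmxA D) (mulmxA D) mulDEt !mul0mx add0r.
  rewrite -(mulmxA _ E D) mulED mulmx0 addr0.
  rewrite !mulmxA -(mulmxA _ E E^T) mulEEt mulmx1 mulmxK // mulEtE -raddfD.
  rewrite -linearD /= /y subrK; apply/matrixP => i j; rewrite !mxE.
  by [].
rewrite /Jf /leader_cost -/A.
have -> : invmx (lifted_mx L (y *m y^T, y)) = E^T *m invmx A *m E + D.
  by rewrite -[RHS](mulKmx Mu) MN mulmx1.
rewrite mxtraceD mxtrace_mulC mulmxA mulEEt mul1mx.
rewrite mxtrace_diag.
have -> : \sum_j x^T 0 j = Nl%:R.
  by rewrite -sx; apply: eq_bigr => j _; rewrite mxE.
by rewrite addrK.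
Qed.

End LeaderCost.

(** * Correspondence between leader choices and rank-one lifted points *)

Section Lifting.
Variables (R : realType) (n : nat) (L : 'M[R]_n).
Implicit Types (x y : 'cV[R]_n) (Y : 'M[R]_n).

Lemma sum01_eq1 x (k : nat) : (forall i, [set 0; 1] (x i 0)) ->
  \sum_i x i 0 = k%:R -> (0 < k)%N -> exists i, x i 0 = 1.
Proof.
move=> x01 sx k0; apply: contrapT => nx.
have x0 i : x i 0 = 0.
  by case: (x01 i) => // xi1; exfalso; apply: nx; exists i.
by move: sx; rewrite big1 // => /esym/eqP; rewrite pnatr_eq0 -leqn0 leqNgt k0.
Qed.

(** A rank-one matrix factors as a column times a row, so its 2 by 2 minors vanish. *)
Lemma rank1_minor Y i j k l : \rank Y = 1%N -> Y i j * Y k l = Y i l * Y k j.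
Proof.
rewrite -{2 3 4 5}(mulmx_base Y) => rk1.
move: (col_base Y) (row_base Y); rewrite rk1 => c r.
by rewrite !mxE !big_ord1; ring.
Qed.

Lemma rank_outer y i : y i 0 != 0 -> \rank (y *m y^T) = 1%N.
Proof.
move=> yi; apply/eqP; rewrite eqn_leq mulmx_max_rank lt0n mxrank_eq0.
apply: contra_neq yi => /matrixP/(_ i i); rewrite !mxE big_ord1 mxE.
by move/eqP; rewrite mulf_eq0 orbb => /eqP.
Qed.

Lemma possemidef_outer y : possemidef (y *m y^T).
Proof.
split=> [|v]; first by rewrite trmx_mul trmxK.
have -> : v^T *m (y *m y^T) *m v = (v^T *m y) *m (v^T *m y)^T.
  by rewrite trmx_mul trmxK !mulmxA.
by rewrite mxE big_ord1 !mxE -expr2 sqr_ge0.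
Qed.

(* Positive definiteness of the lifted matrix forces [y <= diag Y]: where
   [y i = 1] and [Y i i = 0] its diagonal entry vanishes. The rank constraint
   gives [Y i j = Y i i * Y j j], so both [y] and [diag Y] sum to [Nf]. *)
Lemma rank1_feasible_outer (Nf : nat) Y y :
  (rank1_constraints R n Nf `&` Jf_dom L) (Y, y) -> Y = y *m y^T.
Proof.
case=> [[[/= y01 Y01 sy sY [Ys _]] rk1] [_ [_ Mpos]]].
have YE i j : Y i j = Y i i * Y j j.
  have Yji : Y j i = Y i j by rewrite -[in LHS]Ys mxE.
  (* The principal minor gives [Y i i * Y j j = Y i j ^ 2], and 0/1 entries are idempotent. *)
  rewrite (rank1_minor i i j j rk1) Yji.
  by case: (Y01 i j) => ->; rewrite ?mulr0 ?mulr1.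
have le_y i : y i 0 <= Y i i.
  case: (y01 i) => yi; case: (Y01 i i) => Yi; rewrite yi Yi ?ler01 ?lexx //.
  have : 0 < form (lifted_mx L (Y, y)) (delta_mx i 0) (delta_mx i 0).
    apply: Mpos; apply/eqP => /matrixP/(_ i 0); rewrite !mxE !eqxx => /eqP.
    by rewrite oner_eq0.
  by rewrite form_delta !mxE eqxx Yi yi mulr0 subrr add0r mul0rn ltxx.
have sYd : \sum_i Y i i = Nf%:R.
  have sd0 : 0 <= \sum_i Y i i.
    by apply: sumr_ge0 => i _; case: (Y01 i i) => ->; rewrite ?ler01.
  apply/eqP; rewrite -(eqrXn2 (n := 2)) ?ler0n // -sY expr2 mulr_suml.
  by apply/eqP/eq_bigr => i _; rewrite mulr_sumr; apply: eq_bigr => j _.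
have yE i : y i 0 = Y i i.
  have /eqP : \sum_i (Y i i - y i 0) = 0 by rewrite sumrB sYd sy subrr.
  rewrite psumr_eq0 => [/allP/(_ i)|k _]; last by rewrite subr_ge0.
  by rewrite mem_index_enum subr_eq0 => /(_ isT)/eqP.
by apply/matrixP => i j; rewrite YE !mxE big_ord1 mxE !yE.
Qed.

(** What the lifting takes from a connected graph; [L_grounded] excludes nonzero constant vectors
    once one node is held at zero. *)
Hypothesis L_sym : L^T = L.
Hypothesis L_ge0 : forall v, 0 <= form L v v.
Hypothesis L_grounded : forall v i, form L v v = 0 -> v i 0 = 0 -> v = 0.

(** The form splits into the [L]-energy of the follower part [w] of [v] and the squares of the
    leader entries. If both vanish, grounding at the leader [i0] gives [w = 0], and the leader
    entries are zero too. *)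
Lemma posdef_lifted_outer y i0 : (forall i, [set 0; 1] (y i 0)) ->
  y i0 0 = 0 -> posdef (lifted_mx L (y *m y^T, y)).
Proof.
move=> y01 yi0; split.
  apply/matrixP => i j; rewrite !mxE !big_ord1 !mxE -[in LHS]L_sym mxE.
  rewrite (mulrC (y j 0)) eq_sym; congr (_ + _).
  by case: eqVneq => [->|].
move=> v v0; set w : 'cV[R]_n := \col_i (y i 0 * v i 0).
have formE' : form (lifted_mx L (y *m y^T, y)) v v =
    form L w w + \sum_i (1 - y i 0) * v i 0 ^+ 2.
  rewrite !formE -big_split; apply: eq_bigr => i _ /=.
  rewrite [X in _ + X](_ : _ =
      \sum_j v i 0 * ((1 - y i 0) *+ (i == j)) * v j 0).
    rewrite -big_split; apply: eq_bigr => j _ /=.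
    by rewrite !mxE big_ord1 !mxE; ring.
  rewrite (bigD1 i) //= eqxx mulr1n big1 ?addr0 => [|j]; first by ring.
  by rewrite eq_sym => /negPf ->; rewrite mulr0n mulr0 mul0r.
rewrite -[X in 0 < X]/(form _ v v) formE'.
have s_ge0 i : 0 <= (1 - y i 0) * v i 0 ^+ 2.
  by rewrite mulr_ge0 ?sqr_ge0 // subr_ge0; case: (y01 i) => ->; rewrite ?ler01.
have S_ge0 : 0 <= \sum_i (1 - y i 0) * v i 0 ^+ 2 by apply: sumr_ge0.
rewrite lt_neqAle addr_ge0 // andbT eq_sym paddr_eq0 //.
apply/negP => /andP[/eqP w0 /eqP S0].
have wE : w = 0 by apply: (L_grounded (i := i0)) => //; rewrite mxE yi0 mul0r.
move/eqP: v0; apply; apply/matrixP => i j; rewrite (ord1 j) !mxE.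
case: (y01 i) => yi.
  move/eqP: S0; rewrite psumr_eq0 // => /allP/(_ i).
  by rewrite mem_index_enum yi subr0 mul1r sqrf_eq0 => /(_ isT)/eqP.
by move/matrixP: wE => /(_ i 0); rewrite !mxE yi mul1r.
Qed.

(** Makes [x = 1 - y] a bijection between the two feasible sets, along which optima are
    transported. *)
Lemma rank1_feasibleP (Nl : nat) Y y : (0 < Nl < n)%N ->
  (rank1_constraints R n (n - Nl) `&` Jf_dom L) (Y, y) <->
  Y = y *m y^T /\ leader_feasible R n Nl (const_mx 1 - y).
Proof.
move=> /andP[Nl0 Nln].
have sumE : \sum_i (const_mx 1 - y) i 0 = n%:R - \sum_i y i 0.
  under eq_bigr do rewrite !mxE.
  by rewrite sumrB sumr_const card_ord.
split=> [pF|[->]].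
  split; first exact: rank1_feasible_outer pF.
  case: pF => [[[/= y01 _ sy _ _] _] _]; split=> [i|].
    by rewrite !mxE; case: (y01 i) => /= yi; [right|left] => /=; lra.
  by rewrite sumE sy natrB ?(ltnW Nln) // subKr.
case=> x01; rewrite sumE => sx.
have y01 i : [set 0; 1] (y i 0).
  by case: (x01 i); rewrite /= !mxE => h; [right|left] => /=; lra.
have sy : \sum_i y i 0 = (n - Nl)%:R by rewrite natrB ?(ltnW Nln) // -sx subKr.
(* A follower [i1] keeps [y y^T] from being zero, so its rank is exactly one; a leader [i0] grounds
   the form of [L]. *)
have [i1 yi1] : exists i, y i 0 = 1 by apply: sum01_eq1 sy _; rewrite ?subn_gt0.
have [i0 yi0] : exists i, y i 0 = 0.
  have [i xi] : exists i, (const_mx 1 - y) i 0 = 1.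
    by apply: sum01_eq1 x01 _ Nl0; rewrite sumE.
  by exists i; move: xi; rewrite !mxE; lra.
split; last first.
  by split; [case: (possemidef_outer y)|exact: posdef_lifted_outer yi0].
split; last by apply: (rank_outer (i := i1)); rewrite yi1 oner_eq0.
split=> //=.
- move=> i j; rewrite mxE big_ord1 mxE.
  case: (y01 i) => ->; first by rewrite mul0r; left.
  by rewrite mul1r; exact: y01.
- rewrite -sy expr2 mulr_suml; apply: eq_bigr => i _.
  by rewrite mulr_sumr; apply: eq_bigr => j _; rewrite mxE big_ord1 mxE.
- exact: possemidef_outer.
Qed.

Lemma Jf_rank1_feasible (Nl : nat) Y y : (0 < Nl < n)%N ->
  (rank1_constraints R n (n - Nl) `&` Jf_dom L) (Y, y) ->
  Jf L Nl (Y, y) = leader_cost L (const_mx 1 - y).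
Proof.
move=> hN pF; have [_ [_ pd]] := pF.
have [YE [x01 sx]] := (rank1_feasibleP Y y hN).1 pF.
by rewrite -(Jf_outer x01 sx) subKr -YE.
Qed.

End Lifting.

(** * The Laplacian quadratic form of a connected graph *)

Section Laplacian.
Variables (R : realType) (n : nat) (e : rel 'I_n).
Hypotheses (e_sym : symmetric e) (e_irr : irreflexive e).

Lemma laplacian_sym : (laplacian R e)^T = laplacian R e.
Proof.
apply/matrixP => i j; rewrite !mxE eq_sym.
by case: eqP => [->//|_]; rewrite e_sym.
Qed.

(** The factor [2] appears because the double sum meets each edge in both orientations. *)
Lemma form_laplacian (v : 'cV[R]_n) :
  2 * form (laplacian R e) v v =
    \sum_i \sum_j (e i j)%:R * (v i 0 - v j 0) ^+ 2.
Proof.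
have degE i : \sum_j (e i j)%:R * v i 0 ^+ 2 = #|e i|%:R * v i 0 ^+ 2.
  rewrite -mulr_suml -sum1_card natr_sum [in RHS]big_mkcond; congr (_ * _).
  by apply: eq_bigr => j _; rewrite unfold_in; case: (e i j).
have formE' : form (laplacian R e) v v = \sum_i #|e i|%:R * v i 0 ^+ 2 -
    \sum_i \sum_j (e i j)%:R * (v i 0 * v j 0).
  rewrite formE -sumrB; apply: eq_bigr => i _ /=.
  rewrite (bigD1 i) //= [in RHS](bigD1 i) //= e_irr mul0r add0r mxE eqxx.
  rewrite -sumrN; congr (_ + _); first by ring.
  by apply: eq_bigr => j ji; rewrite mxE eq_sym (negPf ji); ring.
rewrite formE'; pose S i j : R := (e i j)%:R * v i 0 ^+ 2.
have SE : \sum_i #|e i|%:R * v i 0 ^+ 2 = \sum_i \sum_j S i j.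
  by apply: eq_bigr => i _; rewrite degE.
(* Swapping the indices in one of the two copies of the degree term supplies the [v j 0 ^+ 2] of
   each square. *)
have SE' : \sum_i \sum_j S i j = \sum_i \sum_j S j i by rewrite exchange_big.
rewrite SE mulrBr [2 * _]mulrDl mul1r {1}SE' -big_split mulr_sumr -sumrB.
apply: eq_bigr => i _ /=; rewrite -big_split mulr_sumr -sumrB.
by apply: eq_bigr => j _ /=; rewrite /S (e_sym j i); ring.
Qed.

Lemma form_laplacian_ge0 (v : 'cV[R]_n) : 0 <= form (laplacian R e) v v.
Proof.
rewrite -(pmulr_rge0 _ (ltr0n R 2)) form_laplacian.
by do 2![apply: sumr_ge0 => ? _]; rewrite mulr_ge0 ?sqr_ge0.
Qed.

(** Zero energy kills every edge term, so the value zero at [i] propagates along paths to all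
    nodes. *)
Lemma laplacian_grounded (e_conn : forall i j, connect e i j)
    (v : 'cV[R]_n) i : form (laplacian R e) v v = 0 -> v i 0 = 0 -> v = 0.
Proof.
move=> f0 vi; have := form_laplacian v; rewrite f0 mulr0 => /esym/eqP.
have t_ge0 k l : 0 <= (e k l)%:R * (v k 0 - v l 0) ^+ 2.
  by rewrite mulr_ge0 ?sqr_ge0.
rewrite psumr_eq0 => [/allP h|k _]; last by apply: sumr_ge0.
have step k l : e k l -> v k 0 = 0 -> v l 0 = 0.
  move=> ekl vk; have := h k; rewrite mem_index_enum => /(_ isT).
  rewrite psumr_eq0 // => /allP/(_ l); rewrite mem_index_enum => /(_ isT).
  by rewrite ekl mul1r vk sub0r sqrrN sqrf_eq0 => /eqP.
apply/matrixP => j k; rewrite (ord1 k) !mxE.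
have /connectP[p pp ->] := e_conn i j.
elim: p i vi pp => //= a p IH i vi /andP[eia pp].
exact: IH (step _ _ eia vi) pp.
Qed.

End Laplacian.

(** * Equivalence of the two problems, and the convex lower bound *)

Theorem mainTheorem2 (R : realType) (n Nl : nat) (e : rel 'I_n)
    (e_sym : symmetric e) (e_irr : irreflexive e)
    (e_conn : forall i j : 'I_n, connect e i j)
    (Nl_gt0 : (1 <= Nl)%N) (Nl_ltn : (Nl < n)%N) :
  let L := laplacian R e in
  let Nf := (n - Nl)%N in
  let rank1_feasible := rank1_constraints R n Nf `&` Jf_dom L in
  let relaxed_feasible := relaxed_constraints R n Nf `&` Jf_dom L in
  [/\ (optimal_value (leader_feasible R n Nl) (leader_cost L)
         = optimal_value rank1_feasible (Jf L Nl)),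
      (forall (Y : 'M[R]_n) (y : 'cV[R]_n),
         optimal rank1_feasible (Jf L Nl) (Y, y) <->
         Y = y *m y^T /\
         optimal (leader_feasible R n Nl) (leader_cost L) (const_mx 1 - y)),
      convex_problem (Jf_dom L) (Jf L Nl) (relaxed_constraints R n Nf)
    & (optimal_value relaxed_feasible (Jf L Nl)
         <= optimal_value (leader_feasible R n Nl) (leader_cost L))%E].
Proof.
move=> L Nf rank1_feasible relaxed_feasible.
have hN : (0 < Nl < n)%N by rewrite Nl_gt0.
have feasP Y y := rank1_feasibleP (laplacian_sym R e_sym)
  (form_laplacian_ge0 e_sym e_irr) (laplacian_grounded e_sym e_irr e_conn)
  Y y hN.
have costE Y y := Jf_rank1_feasible (laplacian_sym R e_sym)
  (form_laplacian_ge0 e_sym e_irr) (laplacian_grounded e_sym e_irr e_conn)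
  (Y := Y) (y := y) hN.
have liftP x : leader_feasible R n Nl x -> rank1_feasible
    ((const_mx 1 - x) *m (const_mx 1 - x)^T, const_mx 1 - x).
  by move=> xF; apply/feasP; rewrite subKr.
have valE : optimal_value (leader_feasible R n Nl) (leader_cost L)
    = optimal_value rank1_feasible (Jf L Nl).
  (* The sets of attained values coincide, hence so do their infima. *)
  congr ereal_inf; apply/seteqP; split=> [_ [x xF <-]|_ [[Y y] pF <-]].
    exists ((const_mx 1 - x) *m (const_mx 1 - x)^T, const_mx 1 - x).
      exact: liftP.
    by rewrite (costE _ _ (liftP x xF)) subKr.
  by exists (const_mx 1 - y); [case: ((feasP Y y).1 pF)|rewrite (costE _ _ pF)].
split=> //.
- move=> Y y; split=> [[pF popt]|[YE [xF xopt]]].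
    have [YE xF] := (feasP Y y).1 pF; split=> //; split=> // x' x'F.
    have := popt _ (liftP x' x'F).
    by rewrite (costE _ _ pF) (costE _ _ (liftP x' x'F)) subKr.
  have pF : rank1_feasible (Y, y) by apply/feasP.
  split=> // -[Y' y'] pF'; rewrite (costE _ _ pF) (costE _ _ pF').
  by apply: xopt; case: ((feasP Y' y').1 pF').
- exact: convex_relaxed_problem.
(* By [valE] it is enough that the relaxed feasible set contains the rank-one one. *)
- rewrite valE; apply: ereal_inf_le_tmp; apply: image_subset.
  move=> p [[[y01 Y01 sy sY Yp] _] pD]; split=> //; split=> // [i|i j] /=.
    by rewrite in_itv /=; case: (y01 i) => ->; rewrite ?ler01 ?lexx.
  by rewrite in_itv /=; case: (Y01 i j) => ->; rewrite ?ler01 ?lexx.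
Qed.
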